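(* Let $\Gamma = (\mathcal{V}, \mathcal{E})$ be a non-empty connected undirected graph (loops and multiple edges allowed), and let $\mathcal{G}(\Gamma) = \big(\Gamma,\ G_{v}\ (v \in \mathcal{V}),\ H_{e},\ \varphi_{\pm e}\ (e \in \mathcal{E})\big)$ be a graph of groups over $\Gamma$. Suppose that $\mathcal{C}$ is a root class of groups and there exists a homomorphism $\sigma$ of $\pi_{1}(\mathcal{G}(\Gamma))$ onto a $\mathcal{C}$-group that acts injectively on all edge subgroups $H_{\varepsilon e}$ ($e \in \mathcal{E}$, $\varepsilon = \pm 1$). If $N = \ker\sigma$ and $\Omega = \{N \cap G_{v} \mid v \in \mathcal{V}\}$, then $\pi_{1}(\mathcal{G}(\Gamma))$ is an extension of a $\mathcal{P}(\Omega)$-group by a $\mathcal{C}$-group.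
   Context: Classes of groups are understood to be closed under isomorphism. A class of groups $\mathcal{C}$ is a root class if it contains non-trivial groups and is closed under taking subgroups, extensions, and Cartesian (unrestricted) products of the form $\prod_{y \in Y} X_{y}$, where $X, Y \in \mathcal{C}$ and $X_{y}$ is an isomorphic copy of $X$ for each $y \in Y$. For a class $\mathcal{K}$, a $\mathcal{K}$-group is a group belonging to $\mathcal{K}$. An extension of a group $A$ by a group $B$ is a group having a normal subgroup isomorphic to $A$ with quotient isomorphic to $B$. For any family of groups $\Omega$, $\mathcal{P}(\Omega)$ denotes the class of groups consisting of (ordinary) free products, each factor of which is a free group or can be embedded in a group from $\Omega$. Maps of groups are written on the right. A (directed) graph of groups $\mathcal{G}(\Gamma)$ over $\Gamma$ assigns to each vertex $v \in \mathcal{V}$ a group $G_v$, and to each edge $e \in \mathcal{E}$ a direction (i.e. a labelling of its ends as $e(1)$ and $e(-1)$), a group $H_e$, and injective homomorphisms $\varphi_{+e}\colon H_e \to G_{e(1)}$, $\varphi_{-e}\colon H_e \to G_{e(-1)}$. The groups $G_v$ are the vertex groups; the subgroups $H_{+e} = H_e\varphi_{+e} \leqslant G_{e(1)}$ and $H_{-e} = H_e\varphi_{-e} \leqslant G_{e(-1)}$ are the edge subgroups; $H_{\varepsilon e}$ for $\varepsilon = \pm 1$ means $H_{+e}$ or $H_{-e}$. For a maximal tree $\mathcal{T} = (\mathcal{V}, \mathcal{E}_{\mathcal{T}})$ in $\Gamma$, the fundamental group $\pi_1(\mathcal{G}(\Gamma)) = \pi_1(\mathcal{G}(\Gamma), \mathcal{T})$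 is the group generated by the generators of the groups $G_v$ ($v \in \mathcal{V}$) and symbols $t_e$ ($e \in \mathcal{E} \setminus \mathcal{E}_{\mathcal{T}}$), with defining relations: the relations of the $G_v$; $h\varphi_{+e} = h\varphi_{-e}$ ($e \in \mathcal{E}_{\mathcal{T}}$, $h \in H_e$); and $t_e^{-1}(h\varphi_{+e})t_e = h\varphi_{-e}$ ($e \in \mathcal{E} \setminus \mathcal{E}_{\mathcal{T}}$, $h \in H_e$). Up to isomorphism it does not depend on $\mathcal{T}$, and the vertex groups $G_v$ embed naturally in it and are regarded as its subgroups. *)

(* Defs.v *)
From HB Require Import structures.
From mathcomp Require Import all_boot.
From mathcomp Require Import boolp classical_sets.

Set Implicit Arguments.
Unset Strict Implicit.
Unset Printing Implicit Defensive.

Local Open Scope classical_set_scope.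
Local Open Scope group_scope.
Local Open Scope quotient_scope.

Definition embeds (G H : groupType) : Prop :=
  exists f : {multiplicative G -> H}, injective f.

Definition isomorphic (G H : groupType) : Prop :=
  exists f : {multiplicative G -> H}, bijective f.

Definition subgroup (G : groupType) (S : groupClosed G) := {x : G | x \in S}.

Section Subgroup.
Variables (G : groupType) (S : groupClosed G).

Lemma subgroup_closed : group_closed (fun x : G => x \in S).
Proof. by split=> [|x y xS yS]; [exact: gpred1 | exact: gpredF]. Qed.

HB.instance Definition _ := SubChoice.on (subgroup S).
HB.instance Definition _ :=
  SubChoice_isSubGroup.Build G (fun x => x \in S) (subgroup S) subgroup_closed.

End Subgroup.

Section KernelImage.
Variables (G H : groupType) (f : {multiplicative G -> H}).

Definition kernel : {pred G} := [pred x | f x == 1].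
Definition hom_image : {pred H} := [pred y | `[< exists x, f x = y >]].

Lemma hom1 : f 1 = 1.
Proof. by apply: (mulgI (f 1)); rewrite -gmulfM !mulg1. Qed.

Lemma homV x : f x^-1 = (f x)^-1.
Proof. by apply: (mulgI (f x)); rewrite -gmulfM !mulgV hom1. Qed.

Fact kernelM : mulg_closed kernel.
Proof. by move=> x y /eqP fx /eqP fy; rewrite inE gmulfM fx fy mulg1. Qed.
Fact kernel1 : 1 \in kernel. Proof. by rewrite inE hom1. Qed.
Fact kernelV : invg_closed kernel.
Proof. by move=> x /eqP fx; rewrite inE homV fx invg1. Qed.

HB.instance Definition _ := isMulClosed.Build G kernel kernelM.
HB.instance Definition _ := isMul1Closed.Build G kernel kernel1.
HB.instance Definition _ := isInvClosed.Build G kernel kernelV.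

Fact hom_imageM : mulg_closed hom_image.
Proof.
move=> _ _ /asboolP[x <-] /asboolP[y <-]; apply/asboolP.
by exists (x * y); rewrite gmulfM.
Qed.
Fact hom_image1 : 1 \in hom_image.
Proof. by apply/asboolP; exists 1; rewrite hom1. Qed.
Fact hom_imageV : invg_closed hom_image.
Proof.
by move=> _ /asboolP[x <-]; apply/asboolP; exists x^-1; rewrite homV.
Qed.

HB.instance Definition _ := isMulClosed.Build H hom_image hom_imageM.
HB.instance Definition _ := isMul1Closed.Build H hom_image hom_image1.
HB.instance Definition _ := isInvClosed.Build H hom_image hom_imageV.

End KernelImage.

Section Intersection.
Variables (G : groupType) (A B : groupClosed G).

Definition intersection : {pred G} := [predI A & B].

Fact intersectionM : mulg_closed intersection.
Proof.
move=> x y /andP[xA xB] /andP[yA yB].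
by apply/andP; split; apply: gpredM.
Qed.
Fact intersection1 : 1 \in intersection.
Proof. by apply/andP; split; apply: gpred1. Qed.
Fact intersectionV : invg_closed intersection.
Proof. by move=> x /andP[xA xB]; apply/andP; split; apply: gpredVr. Qed.

HB.instance Definition _ := isMulClosed.Build G intersection intersectionM.
HB.instance Definition _ := isMul1Closed.Build G intersection intersection1.
HB.instance Definition _ := isInvClosed.Build G intersection intersectionV.

End Intersection.

Record normalSubgroup (G : groupType) := NormalSubgroup {
  normal_sub :> groupClosed G;
  normal_subJ : forall x y : G, x \in normal_sub -> x ^ y \in normal_sub
}.

Section Quotient.
Variables (G : groupType) (N : normalSubgroup G).

Definition same_coset : rel G := fun x y => x^-1 * y \in normal_sub N.

Fact same_coset_refl : reflexive same_coset.
Proof. by move=> x; rewrite /same_coset mulVg gpred1. Qed.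
Fact same_coset_sym : symmetric same_coset.
Proof. by move=> x y; rewrite /same_coset -gpredV invgM invgK. Qed.
Fact same_coset_trans : transitive same_coset.
Proof.
move=> y x z xy yz; rewrite /same_coset -(mulVKg y z) mulgA; exact: gpredM.
Qed.

Canonical same_coset_equiv :=
  EquivRel same_coset same_coset_refl same_coset_sym same_coset_trans.

Definition quotient_group := {eq_quot same_coset}.
HB.instance Definition _ := Choice.on quotient_group.

Definition coset_class (x : G) : quotient_group := \pi_quotient_group x.
Definition coset_repr (a : quotient_group) : G := repr a.

Lemma coset_classK a : coset_class (coset_repr a) = a.
Proof. exact: reprK. Qed.
Lemma coset_classP x y : coset_class x = coset_class y <-> same_coset x y.
Proof. by split=> [/eqquotP|xy]; last apply/eqquotP. Qed.

Definition quotient_mul a b := coset_class (coset_repr a * coset_repr b).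
Definition quotient_inv a := coset_class (coset_repr a)^-1.

Lemma quotient_mulE x y :
  quotient_mul (coset_class x) (coset_class y) = coset_class (x * y).
Proof.
apply/coset_classP; rewrite /same_coset.
have /coset_classP := coset_classK (coset_class x).
have /coset_classP := coset_classK (coset_class y).
rewrite /same_coset; set a := coset_repr _; set b := coset_repr _ => ay bx.
rewrite invgM -mulgA (_ : _ * _ = (b^-1 * x) ^ a * (a^-1 * y)).
  by apply: gpredM => //; apply: normal_subJ.
by rewrite conjgE !mulgA mulgK.
Qed.

Lemma quotient_invE x : quotient_inv (coset_class x) = coset_class x^-1.
Proof.
apply/coset_classP; rewrite /same_coset invgK.
have /coset_classP := coset_classK (coset_class x).
rewrite /same_coset; set b := coset_repr _ => bx.
have := normal_subJ (b^-1) (gpredVr _ bx).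
by rewrite conjgE invgK invgM !invgK -!mulgA mulgV mulg1 -gpredV invgM invgK
   -gpredV invgM invgK.
Qed.

Fact quotient_mulA : associative quotient_mul.
Proof.
move=> a b c; rewrite -(coset_classK a) -(coset_classK b) -(coset_classK c).
by rewrite !quotient_mulE mulgA.
Qed.
Fact quotient_mul1 : left_id (coset_class 1) quotient_mul.
Proof. by move=> a; rewrite -(coset_classK a) quotient_mulE mul1g. Qed.
Fact quotient_1mul : right_id (coset_class 1) quotient_mul.
Proof. by move=> a; rewrite -(coset_classK a) quotient_mulE mulg1. Qed.
Fact quotient_mulV : left_inverse (coset_class 1) quotient_inv quotient_mul.
Proof.
by move=> a; rewrite -(coset_classK a) quotient_invE quotient_mulE mulVg.
Qed.
Fact quotient_Vmul : right_inverse (coset_class 1) quotient_inv quotient_mul.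
Proof.
by move=> a; rewrite -(coset_classK a) quotient_invE quotient_mulE mulgV.
Qed.

HB.instance Definition _ := isGroup.Build quotient_group
  quotient_mulA quotient_mul1 quotient_1mul quotient_mulV quotient_Vmul.

End Quotient.

Definition is_extension (G A B : groupType) : Prop :=
  exists N : normalSubgroup G,
    isomorphic (subgroup N) A /\ isomorphic (quotient_group N) B.

Definition cartesian_product (I : Type) (F : I -> groupType) :=
  forall i, F i.

Section CartesianProduct.
Variables (I : Type) (F : I -> groupType).
Local Notation P := (cartesian_product F).

HB.instance Definition _ := gen_eqMixin P.
HB.instance Definition _ := gen_choiceMixin P.

Definition prod_one : P := fun=> 1.
Definition prod_inv (a : P) : P := fun i => (a i)^-1.
Definition prod_mul (a b : P) : P := fun i => a i * b i.

Fact prod_mulA : associative prod_mul.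
Proof. by move=> a b c; apply: functional_extensionality_dep => i; apply: mulgA. Qed.
Fact prod_mul1 : left_id prod_one prod_mul.
Proof. by move=> a; apply: functional_extensionality_dep => i; apply: mul1g. Qed.
Fact prod_1mul : right_id prod_one prod_mul.
Proof. by move=> a; apply: functional_extensionality_dep => i; apply: mulg1. Qed.
Fact prod_mulV : left_inverse prod_one prod_inv prod_mul.
Proof. by move=> a; apply: functional_extensionality_dep => i; apply: mulVg. Qed.
Fact prod_Vmul : right_inverse prod_one prod_inv prod_mul.
Proof. by move=> a; apply: functional_extensionality_dep => i; apply: mulgV. Qed.

HB.instance Definition _ := isGroup.Build P
  prod_mulA prod_mul1 prod_1mul prod_mulV prod_Vmul.

End CartesianProduct.

(** In [root_prod] the group [Y] serves as the index set of the product. *)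
Record root_class (C : groupType -> Prop) : Prop := RootClass {
  root_iso : forall G H : groupType, isomorphic G H -> C G -> C H;
  root_nontrivial : exists2 G : groupType, C G & exists x : G, x <> 1;
  root_sub : forall (G : groupType) (S : groupClosed G), C G -> C (subgroup S);
  root_ext : forall G A B : groupType, is_extension G A B -> C A -> C B -> C G;
  root_prod : forall (X Y : groupType) (F : Y -> groupType), C X -> C Y ->
    (forall y, isomorphic (F y) X) -> C (cartesian_product F)
}.

Definition extension_class (P C : groupType -> Prop) (G : groupType) : Prop :=
  exists A B : groupType, [/\ P A, C B & is_extension G A B].

(** The letter [(x, true)] stands for the generator [x], and [(x, false)] for
    its inverse. *)
Definition word (X : Type) := seq (X * bool).

Inductive consequence (X : Type) (R : word X -> word X -> Prop) :
  word X -> word X -> Prop :=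
| cons_rel u v : R u v -> consequence R u v
| cons_cancel x b : consequence R [:: (x, b); (x, ~~ b)] [::]
| cons_cat u u' v v' :
    consequence R u u' -> consequence R v v' -> consequence R (u ++ v) (u' ++ v')
| cons_refl u : consequence R u u
| cons_sym u v : consequence R u v -> consequence R v u
| cons_trans u v w : consequence R u v -> consequence R v w -> consequence R u w.

Section Presentation.
Variables (X : Type) (R : word X -> word X -> Prop).

Definition same_class : rel {classic (word X)} :=
  fun u v => `[< consequence R u v >].

Fact same_class_refl : reflexive same_class.
Proof. by move=> u; apply/asboolP; apply: cons_refl. Qed.
Fact same_class_sym : symmetric same_class.
Proof. by move=> u v; apply: asbool_equiv_eq; split; apply: cons_sym. Qed.
Fact same_class_trans : transitive same_class.
Proof.
by move=> v u w /asboolP uv /asboolP vw; apply/asboolP; apply: cons_trans vw.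
Qed.

Canonical same_class_equiv :=
  EquivRel same_class same_class_refl same_class_sym same_class_trans.

Definition presented := {eq_quot same_class}.
HB.instance Definition _ := Choice.on presented.

Definition word_class (u : word X) : presented := \pi_presented u.
Definition word_repr (a : presented) : word X := repr a.

Lemma word_classK a : word_class (word_repr a) = a.
Proof. exact: reprK. Qed.
Lemma word_classP u v : word_class u = word_class v <-> consequence R u v.
Proof.
split=> [/eqquotP/asboolP //|uv].
by apply/(@eqquotP _ same_class_equiv)/asboolP.
Qed.

Definition word_inv (u : word X) : word X := [seq (l.1, ~~ l.2) | l <- rev u].

Lemma word_inv_cat u v : word_inv (u ++ v) = word_inv v ++ word_inv u.
Proof. by rewrite /word_inv rev_cat map_cat. Qed.

Lemma word_invK : involutive word_inv.
Proof.
move=> u; rewrite /word_inv -map_rev revK -map_comp -[RHS]map_id.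
by apply: eq_map => -[x b] /=; rewrite negbK.
Qed.

Lemma consequence_mulV u : consequence R (u ++ word_inv u) [::].
Proof.
elim: u => [|[x b] u IHu]; first exact: cons_refl.
rewrite -cat1s word_inv_cat -catA (catA u).
apply: (@cons_trans _ _ _ ([:: (x, b)] ++ ([::] ++ word_inv [:: (x, b)]))).
  by do 2?[apply: cons_cat => //; try exact: cons_refl].
exact: cons_cancel.
Qed.

Lemma consequence_mulVl u : consequence R (word_inv u ++ u) [::].
Proof. by have := consequence_mulV (word_inv u); rewrite word_invK. Qed.

Lemma consequence_inv u v :
  consequence R u v -> consequence R (word_inv u) (word_inv v).
Proof.
move=> uv; apply: (@cons_trans _ _ _ (word_inv u ++ (v ++ word_inv v))).
  rewrite -[X in consequence _ X _]cats0; apply: cons_cat; first exact: cons_refl.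
  exact/cons_sym/consequence_mulV.
rewrite catA -[X in consequence _ _ X]cat0s; apply: cons_cat; last exact: cons_refl.
apply: (@cons_trans _ _ _ (word_inv u ++ u)); last exact: consequence_mulVl.
by apply: cons_cat; [exact: cons_refl | exact: cons_sym].
Qed.

Definition presented_mul a b := word_class (word_repr a ++ word_repr b).
Definition presented_inv a := word_class (word_inv (word_repr a)).

Lemma presented_mulE u v :
  presented_mul (word_class u) (word_class v) = word_class (u ++ v).
Proof. by apply/word_classP/cons_cat; apply/word_classP/word_classK. Qed.

Lemma presented_invE u :
  presented_inv (word_class u) = word_class (word_inv u).
Proof. exact/word_classP/consequence_inv/word_classP/word_classK. Qed.

Fact presented_mulA : associative presented_mul.
Proof.
move=> a b c; rewrite -(word_classK a) -(word_classK b) -(word_classK c).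
by rewrite !presented_mulE catA.
Qed.
Fact presented_mul1 : left_id (word_class [::]) presented_mul.
Proof. by move=> a; rewrite -(word_classK a) presented_mulE. Qed.
Fact presented_1mul : right_id (word_class [::]) presented_mul.
Proof. by move=> a; rewrite -(word_classK a) presented_mulE cats0. Qed.
Fact presented_mulV :
  left_inverse (word_class [::]) presented_inv presented_mul.
Proof.
move=> a; rewrite -(word_classK a) presented_invE presented_mulE.
exact/word_classP/consequence_mulVl.
Qed.
Fact presented_Vmul :
  right_inverse (word_class [::]) presented_inv presented_mul.
Proof.
move=> a; rewrite -(word_classK a) presented_invE presented_mulE.
exact/word_classP/consequence_mulV.
Qed.

HB.instance Definition _ := isGroup.Build presented
  presented_mulA presented_mul1 presented_1mul presented_mulV presented_Vmul.

Definition generator (x : X) : presented := word_class [:: (x, true)].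

End Presentation.

Definition free_group (X : Type) : groupType := presented (fun _ _ : word X => False).

Definition is_free (G : groupType) : Prop :=
  exists X : Type, isomorphic G (free_group X).

(** All elements of the factors are taken as generators, and their
    multiplication tables as relations. *)
Inductive free_product_rel (I : Type) (F : I -> groupType) :
  word {i & F i} -> word {i & F i} -> Prop :=
| fprod_mul i (x y : F i) :
    free_product_rel [:: (existT _ i x, true); (existT _ i y, true)]
                     [:: (existT _ i (x * y), true)].

Definition free_product (I : Type) (F : I -> groupType) : groupType :=
  presented (@free_product_rel I F).

Definition P_class (J : Type) (Omega : J -> groupType) (G : groupType) : Prop :=
  exists (I : Type) (F : I -> groupType),
    (forall i, is_free (F i) \/ exists j, embeds (F i) (Omega j)) /\
    isomorphic G (free_product F).

(** Loops and multiple edges are allowed; the edge [e] is a loop when [ends e]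
    is a singleton. *)
Record graph := Graph {
  vertex : Type;
  edge : Type;
  ends : edge -> set vertex;
  endsP : forall e, exists u v, ends e = [set u; v]
}.

Section Walks.
Variables (Gamma : graph) (T : set (edge Gamma)).
Implicit Types (u v : vertex Gamma) (p : seq (edge Gamma * vertex Gamma)).

(** [walk u p]: starting from [u], one traverses successively the edges listed
    in [p], all of them in [T], each edge being paired with the vertex reached. *)
Fixpoint walk u p : Prop :=
  if p is (e, v) :: p' then [/\ T e, ends e = [set u; v] & walk v p'] else True.

Definition walk_end u p : vertex Gamma := last u (unzip2 p).

Definition connected_by : Prop :=
  forall u v, exists2 p, walk u p & walk_end u p = v.

Definition has_circuit : Prop :=
  exists u p, [/\ p <> [::], walk u p, walk_end u p = u,
    uniq (unzip1 p : seq {classic (edge Gamma)}) &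
    uniq (unzip2 p : seq {classic (vertex Gamma)})].

(** [T] is the edge set of a tree whose vertex set is that of [Gamma]. *)
Definition maximal_tree : Prop := connected_by /\ ~ has_circuit.

End Walks.

Definition connected (Gamma : graph) : Prop := connected_by (@setT (edge Gamma)).

(** A sign [+1] or [-1] is encoded by [true] or [false]; thus [edge_end e true]
    is [e(1)] and [edge_hom e true] is [phi_{+e}]. *)
Record graph_of_groups (Gamma : graph) := GraphOfGroups {
  vertex_group : vertex Gamma -> groupType;
  edge_end : edge Gamma -> bool -> vertex Gamma;
  edge_endP : forall e, ends e = [set edge_end e true; edge_end e false];
  edge_group : edge Gamma -> groupType;
  edge_hom : forall (e : edge Gamma) (s : bool),
    {multiplicative edge_group e -> vertex_group (edge_end e s)};
  edge_hom_inj : forall e s, injective (edge_hom e s)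
}.

Section FundamentalGroup.
Variables (Gamma : graph) (GG : graph_of_groups Gamma) (T : set (edge Gamma)).

(** All elements of the vertex groups are taken as generators, and their
    multiplication tables as relations. *)
Inductive pi1_gen : Type :=
| Gvertex v (g : vertex_group GG v)
| Gstable e (eNT : ~ T e).

Inductive pi1_rel : word pi1_gen -> word pi1_gen -> Prop :=
| pi1_vertex v (g h : vertex_group GG v) :
    pi1_rel [:: (Gvertex g, true); (Gvertex h, true)]
            [:: (Gvertex (g * h), true)]
| pi1_tree e (h : edge_group GG e) : T e ->
    pi1_rel [:: (Gvertex (edge_hom GG e true h), true)]
            [:: (Gvertex (edge_hom GG e false h), true)]
| pi1_stable e (h : edge_group GG e) (eNT : ~ T e) :
    pi1_rel [:: (Gstable eNT, false); (Gvertex (edge_hom GG e true h), true);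
                (Gstable eNT, true)]
            [:: (Gvertex (edge_hom GG e false h), true)].

Definition pi1 : groupType := presented pi1_rel.

Definition vertex_map v (g : vertex_group GG v) : pi1 :=
  generator pi1_rel (Gvertex g).

Fact vertex_mapM v : {morph @vertex_map v : g h / g * h}.
Proof.
move=> g h; rewrite [RHS]presented_mulE.
exact/word_classP/cons_sym/cons_rel/pi1_vertex.
Qed.

HB.instance Definition _ v :=
  isMultiplicative.Build (vertex_group GG v) pi1 (@vertex_map v) (@vertex_mapM v).

(** The vertex and edge subgroups are taken inside the fundamental group, via
    the natural maps of the vertex groups; the injectivity of these maps is not
    built in. *)
Definition vertex_subgroup v : groupClosed pi1 := hom_image (@vertex_map v).

Definition edge_subgroup e (s : bool) : groupClosed pi1 :=
  hom_image (@vertex_map (edge_end GG e s) \o edge_hom GG e s).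

End FundamentalGroup.

(* Main.v *)
Require Import Defs.
From HB Require Import structures.
From mathcomp Require Import all_boot.
From mathcomp Require Import boolp classical_sets functions cardinality.

Set Implicit Arguments.
Unset Strict Implicit.
Unset Printing Implicit Defensive.

Local Open Scope classical_set_scope.
Local Open Scope group_scope.

(** The kernel [N] of [sigma] is itself the required free product, the quotient
    being [K].  Geometrically, [N] acts on the Bass-Serre tree with trivial edge
    stabilisers, because these are conjugates of the trivial groups [N :&: H_e];
    hence [N] is the free product of a free group and of conjugates of the groups
    [N :&: G_v].  The tree is not constructed here: the splitting of [N] is
    obtained from presentations and wreath products, as follows.

    Let [pi1] act on [K] by right translation through [sigma].  The
    covering of [Gamma] attached to this action has as vertices the pairs
    (vertex [v], left coset of [sigma G_v] in [K]) and as edges the pairs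
    (edge [e], left coset of [sigma H_e]).  It is connected since [sigma] is onto
    ([cover_connected]); choose a spanning tree [S] of it.  Let [P] be the free
    product of one copy of [N :&: G_v] for each covering vertex over [v], and of
    the free group on the covering edges outside [S].

    A homomorphism from [pi1] to the unrestricted wreath product of [P] by [K]
    that lies over [sigma] is the same as a cocycle [K -> pi1 -> P]; at the
    argument [1] of [K] it restricts to a homomorphism from [N] to [P].  Such a
    cocycle is written down on the generators ([lift_exists]).  The relation
    attached to an edge holds because [sigma] is injective on [H_e], so that a
    point of [K] determines a unique element of [H_e] carrying the chosen
    representative of its coset to it.  Conversely, paths in [S] give a
    homomorphism from [P] to [N] ([realization_exists]).  Both composites are
    inner automorphisms ([realization_cocycle], [cocycle_realization]), hence
    [N] and [P] are isomorphic.

    Two points need a separate argument.  Injectivity of [sigma] is given on the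
    images of the edge groups in [pi1], so one must know that vertex groups embed
    in [pi1] ([vertex_map_inj]); this follows by letting all of them act freely on
    one large set, where isomorphic subgroups acting freely with equally many
    orbits are conjugate.  And the relations [t_e = 1] on the maximal tree [T] are
    met by a change of gauge: any labelling of the edges of a tree by elements of
    a group is the coboundary of a labelling of the vertices
    ([maximal_tree_spanning], [pi1_hom]). *)

(** * Presented groups, free products and kernels *)

Definition bundle_hom (G H : groupType) (f : G -> H)
    (fM : {morph f : x y / x * y}) : {multiplicative G -> H} :=
  HB.pack f (isMultiplicative.Build G H f fM).

Lemma inj_surj_bij (A B : Type) (f : A -> B) :
  injective f -> (forall y, exists x, f x = y) -> bijective f.
Proof.
move=> f_inj /choice[g gK]; exists g => [x|//].
by apply: f_inj; rewrite gK.
Qed.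

Section PresentedGroups.
Variables (X : Type) (R : word X -> word X -> Prop).

Lemma presented_ind (P : presented R -> Prop) :
  P 1 -> (forall x, P (generator R x)) -> (forall a b, P a -> P b -> P (a * b)) ->
  (forall a, P a -> P a^-1) -> forall a, P a.
Proof.
move=> P1 Pgen PM PV a; rewrite -(word_classK a).
elim: (word_repr a) => [//|[x b] u IHu].
have -> : word_class R ((x, b) :: u) = word_class R [:: (x, b)] * word_class R u.
  by rewrite [RHS]presented_mulE.
apply: PM IHu; case: b; first exact: Pgen.
by have := PV _ (Pgen x); rewrite [(generator R x)^-1]presented_invE.
Qed.

Section Evaluation.
Variables (L : groupType) (f : X -> L).

Definition eval_letter (l : X * bool) : L := if l.2 then f l.1 else (f l.1)^-1.
Definition eval_word (u : word X) : L := foldr (fun l z => eval_letter l * z) 1 u.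

Lemma eval_word_cat u v : eval_word (u ++ v) = eval_word u * eval_word v.
Proof. by elim: u => [|l u IHu] /=; rewrite ?mul1g // IHu mulgA. Qed.

Lemma eval_word_consequence :
  (forall u v, R u v -> eval_word u = eval_word v) ->
  forall u v, consequence R u v -> eval_word u = eval_word v.
Proof.
move=> Rf u v.
elim=> {u v} [u v /Rf //|x b|u u' v v' _ uu' _ vv'|//|//|u v w _ -> _ //].
  by case: b; rewrite /= mulg1 (mulgV, mulVg).
by rewrite !eval_word_cat uu' vv'.
Qed.

(** Von Dyck: a map of the generators into a group that respects the relators
    extends to the presented group. *)
Lemma presented_hom : (forall u v, R u v -> eval_word u = eval_word v) ->
  exists h : {multiplicative presented R -> L}, forall x, h (generator R x) = f x.
Proof.
move=> Rf; pose h (a : presented R) := eval_word (word_repr a).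
have hE u : h (word_class R u) = eval_word u.
  by apply: eval_word_consequence => //; apply/word_classP/word_classK.
have hM : {morph h : a b / a * b}.
  by move=> a b; rewrite -[a * b]/(word_class R _) hE eval_word_cat.
by exists (bundle_hom hM) => x; rewrite [LHS]hE /= mulg1.
Qed.

End Evaluation.
End PresentedGroups.

Lemma free_group_hom (X : Type) (L : groupType) (f : X -> L) :
  exists h : {multiplicative free_group X -> L},
    forall x, h (generator (fun _ _ => False) x) = f x.
Proof. by apply: presented_hom. Qed.

Section FreeProduct.
Variables (I : Type) (F : I -> groupType).

Definition factor_map i (x : F i) : free_product F :=
  generator (@free_product_rel I F) (existT F i x).

Fact factor_mapM i : {morph @factor_map i : x y / x * y}.
Proof.
move=> x y; rewrite [RHS]presented_mulE.
exact/word_classP/cons_sym/cons_rel/fprod_mul.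
Qed.

HB.instance Definition _ i :=
  isMultiplicative.Build (F i) (free_product F) (@factor_map i) (@factor_mapM i).

Lemma free_product_hom (L : groupType) (f : forall i, {multiplicative F i -> L}) :
  exists h : {multiplicative free_product F -> L},
    forall i x, h (@factor_map i x) = f i x.
Proof.
have [|h hE] := @presented_hom _ (@free_product_rel I F) L
    (fun p => f (tag p) (tagged p)).
  by move=> _ _ [i x y]; rewrite /= !mulg1 /eval_letter /= gmulfM.
by exists h => i x; rewrite hE.
Qed.

Lemma free_product_ind (P : free_product F -> Prop) :
  P 1 -> (forall i x, P (@factor_map i x)) -> (forall a b, P a -> P b -> P (a * b)) ->
  (forall a, P a -> P a^-1) -> forall a, P a.
Proof. by move=> P1 Pf PM PV; apply: presented_ind => // -[i x]; apply: Pf. Qed.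

End FreeProduct.

Section FirstIsomorphism.
Variables (G H : groupType) (f : {multiplicative G -> H}).

Fact kernelJ x y : x \in kernel f -> x ^ y \in kernel f.
Proof. by rewrite !inE conjgE !gmulfM homV => /eqP ->; rewrite mul1g mulVg. Qed.

Definition kernel_normal : normalSubgroup G := NormalSubgroup kernelJ.

Lemma quotient_kernel : range f = [set: H] ->
  isomorphic (quotient_group kernel_normal) H.
Proof.
move=> f_onto; pose h (a : quotient_group kernel_normal) := f (coset_repr a).
have hE x : h (coset_class kernel_normal x) = f x.
  have /coset_classP := coset_classK (coset_class kernel_normal x).
  rewrite /same_coset inE gmulfM homV => /eqP hx.
  by apply: (mulgI (h (coset_class kernel_normal x))^-1); rewrite mulVg hx.
have hM : {morph h : a b / a * b}.
  by move=> a b; rewrite -[a * b]/(coset_class _ _) hE gmulfM.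
exists (bundle_hom hM); apply: inj_surj_bij => [a b|y] /=.
  rewrite -(coset_classK a) -(coset_classK b) !hE => fab.
  by apply/coset_classP; rewrite /same_coset inE gmulfM homV fab mulVg.
have [x _ <-] : range f y by rewrite f_onto.
by exists (coset_class kernel_normal x); rewrite /= hE.
Qed.

End FirstIsomorphism.

(** * Spanning trees *)

Section SpanningTrees.
Variables (V E : Type) (src tgt : E -> V).
Implicit Types (S T : set E) (P : V -> Prop).

Definition edge_stable S P := forall e, S e -> (P (src e) <-> P (tgt e)).

(** Connectedness in the form of an induction principle: this is how it is used
    for the covering graph, where walks would have to be lifted from [Gamma]. *)
Definition edge_connected S :=
  forall P, edge_stable S P -> forall u v, P u -> P v.

(** Every [L]-valued edge labelling is a coboundary.  For a connected [S] this
    says that [S] has no circuits, and it is the only consequence of the absence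
    of circuits that the constructions below need. *)
Definition edge_solvable S r := forall (L : groupType) (l : E -> L) (x : L),
  exists2 q : V -> L, q r = x & forall e, S e -> q (src e) * l e = q (tgt e).

Definition spanning_tree S r := edge_connected S /\ edge_solvable S r.

Definition traverses (a : E * bool) u v :=
  if a.2 then src a.1 = u /\ tgt a.1 = v else src a.1 = v /\ tgt a.1 = u.

Inductive reached S r : nat -> V -> Prop :=
| reached0 : reached S r 0 r
| reachedS n u v a : reached S r n u -> S a.1 -> traverses a u v ->
    reached S r n.+1 v.

Lemma reached_connected S r v : edge_connected S -> exists n, reached S r n v.
Proof.
move=> /(_ (fun v => exists n, reached S r n v)); apply.
- move=> e Se; split=> -[n rn]; exists n.+1.
    by apply: (reachedS (a := (e, true)) rn Se).
  by apply: (reachedS (a := (e, false)) rn Se).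
- by exists 0; apply: reached0.
Qed.

Lemma distance_exists S r : edge_connected S -> exists d : V -> nat,
  forall v, v <> r -> exists (p : (E * bool) * V),
    [/\ S p.1.1, traverses p.1 p.2 v & d p.2 < d v].
Proof.
move=> Sc; have rn v : exists n, `[< reached S r n v >].
  by have [n rn] := reached_connected r v Sc; exists n; apply/asboolP.
exists (fun v => ex_minn (rn v)) => v vr.
case: (ex_minnP (rn v)) => n /asboolP rnv _.
case: {n v} rnv vr => [//|n u v a ru Sa av _].
exists (a, u); split=> //=; rewrite ltnS.
by case: ex_minnP => m _; apply; apply/asboolP.
Qed.

(** Every vertex other than [r] is joined by some edge to a vertex closer to [r];
    one such edge for each vertex gives [S].  The required [q] is then defined
    by recursion on the distance to [r]. *)
Lemma exists_spanning_tree T r : edge_connected T ->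
  exists2 S, S `<=` T & spanning_tree S r.
Proof.
move=> /(distance_exists r)[d /= dP].
have /choice[p pP] : forall v : {v | v <> r}, exists p : (E * bool) * V,
    [/\ T p.1.1, traverses p.1 p.2 (sval v) & d p.2 < d (sval v)].
  by move=> [v vr]; apply: dP.
exists [set e | exists v, (p v).1.1 = e] => [_ [v <-]|]; first by case: (pP v).
split=> [P Pst|L l x].
  have Pr v : P v <-> P r.
    have [n] := ubnP (d v); elim: n v => // n IHn v dvn.
    have [-> //|/eqP vr] := eqVneq (v : {classic V}) r.
    have := pP (exist _ v vr); set a := p _ => -[_ av dv] /=.
    rewrite -(IHn a.2); last exact: leq_trans dv _.
    have /Pst : exists v, (p v).1.1 = a.1.1 by exists (exist _ v vr).
    by move: av; rewrite /traverses; case: a.1.2 => -[-> ->] [].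
  by move=> u v /Pr ?; apply/Pr.
pose step (a : E * bool) := if a.2 then l a.1 else (l a.1)^-1.
(* The argument [n] is fuel: [q n v] has its final value once [n > d v]. *)
pose fix q (n : nat) (v : V) {struct n} : L := if n is n'.+1 then
    if pselect (v <> r) is left vr
    then q n' (p (exist _ v vr)).2 * step (p (exist _ v vr)).1 else x else x.
have qE n m v : d v < n -> d v < m -> q n v = q m v.
  elim: n m v => [//|n IHn] [//|m] v dn dm /=; case: pselect => // vr.
  have [_ _ /= dv] := pP (exist _ v vr).
  by congr (_ * _); apply: IHn; apply: leq_trans dv _.
pose q' v := q (d v).+1 v.
exists q' => [|_ [[v vr] <-]]; first by rewrite /q' /=; case: pselect.
have := pP (exist _ v vr); set a := p _ => -[_ /= av dv].
have qv : q' v = q' a.2 * step a.1.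
  rewrite {1}/q' /=; case: pselect => // vr'.
  by rewrite (Prop_irrelevance vr' vr) -/a; congr (_ * _); apply: qE.
by move: av qv; rewrite /traverses /step; case: a.1.2 => -[-> ->] ->;
  rewrite ?mulgVK.
Qed.

End SpanningTrees.

Section Circuits.
Variable Gamma : graph.
Implicit Types (S T : set (edge Gamma)) (u v w : {classic (vertex Gamma)}).
Implicit Types (p : seq ({classic (edge Gamma)} * {classic (vertex Gamma)})).

Lemma walk_sub S T u p : S `<=` T -> walk S u p -> walk T u p.
Proof. by move=> ST; elim: p u => //= -[e v] p IHp u [/ST Te uv /IHp]. Qed.

Lemma walk_rcons T u p e v : walk T u p -> T e ->
  ends e = [set walk_end u p; v] -> walk T u (rcons p (e, v)).
Proof.
rewrite /walk_end.
by elim: p u => //= -[f w] p IHp u [Tf fuw wp] Te ev; split=> //; apply: IHp.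
Qed.

Lemma walk_end_rcons u p e v : walk_end u (rcons p (e, v)) = v.
Proof. by rewrite /walk_end /unzip2 map_rcons last_rcons. Qed.

Lemma walk_drop T u v p : walk T u p -> uniq (u :: unzip2 p) ->
  v \in u :: unzip2 p ->
  exists2 p', walk T v p' & walk_end v p' = walk_end u p /\ uniq (v :: unzip2 p').
Proof.
elim: p u => [|[e w] p IHp] u /= => [_ _|].
  by rewrite inE => /eqP ->; exists [::].
move=> [Te euw wp] /andP[uwp wu]; rewrite inE => /orP[/eqP ->|].
  by exists ((e, w) :: p) => //=; rewrite uwp.
by move=> /(IHp _ wp wu).
Qed.

Lemma simple_walk T u p : walk T u p ->
  exists2 p', walk T u p' & walk_end u p' = walk_end u p /\ uniq (u :: unzip2 p').
Proof.
elim: p u => [|[e v] p IHp] u /= => [_|[Te euv /IHp[p' wp' [vp' up']]]].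
  by exists [::].
case: (boolP (u \in v :: unzip2 p')) => uin.
  by have [p'' ? [e'' ?]] := walk_drop wp' up' uin; exists p''; rewrite ?e''.
by exists ((e, v) :: p') => //; split=> //; rewrite /= uin.
Qed.

(** Used to see that a walk without repeated vertices repeats no edge: meeting
    an edge again means meeting both of its ends again. *)
Lemma walk_ends T u p e v : walk T u p -> e \in unzip1 p -> ends e v ->
  v \in u :: unzip2 p.
Proof.
elim: p u => //= -[f w] p IHp u [_ fuw wp]; rewrite inE => /orP[/eqP ->|ep ev].
  by rewrite fuw => -[->|->]; rewrite !inE eqxx ?orbT.
by rewrite inE (IHp w) ?orbT.
Qed.

Lemma simple_walk_edges T u p : walk T u p -> uniq (u :: unzip2 p) ->
  uniq (unzip1 p).
Proof.
elim: p u => //= -[e v] p IHp u [_ euv wp] /andP[uvp /[dup] uv /(IHp _ wp) ->].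
rewrite andbT; apply: contra uvp => ep; apply: (walk_ends wp ep).
by rewrite euv; left.
Qed.

Lemma set2_inj (V : Type) (a b c d : V) : [set a; b] = [set c; d] ->
  (c = a /\ d = b) \/ (c = b /\ d = a).
Proof.
move=> eq_s; have ca : [set a; b] c by rewrite eq_s; left.
have da : [set a; b] d by rewrite eq_s; right.
have ac : [set c; d] a by rewrite -eq_s; left.
have bc : [set c; d] b by rewrite -eq_s; right.
by case: ca da ac bc => ? [] ? [] ? [] ?;
  by [left; split; congruence | right; split; congruence].
Qed.

Variables (GG : graph_of_groups Gamma).
Let src e := edge_end GG e true.
Let tgt e := edge_end GG e false.

Lemma connected_by_edge_connected T : connected_by T -> edge_connected src tgt T.
Proof.
move=> Tc P Pst u v; have [p wp <-] := Tc u v.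
elim: p u wp => //= -[e w] p IHp u [/Pst Pe euw wp] Pu; apply: (IHp _ wp).
have [[es et]|[es et]] := set2_inj (etrans (esym euw) (edge_endP GG e)).
- by rewrite /tgt et in Pe; apply/Pe; rewrite /src es.
- by rewrite /src es in Pe; apply/Pe; rewrite /tgt et.
Qed.

Lemma edge_connected_walk T u v : edge_connected src tgt T ->
  exists2 p, walk T u p & walk_end u p = v.
Proof.
move=> /(_ (fun v => exists2 p, walk T u p & walk_end u p = v)); apply.
  move=> e Te; split=> -[p wp pe].
    exists (rcons p (e, tgt e)); last exact: walk_end_rcons.
    by apply: walk_rcons; rewrite // pe (edge_endP GG).
  exists (rcons p (e, src e)); last exact: walk_end_rcons.
  by apply: walk_rcons; rewrite // pe setUC (edge_endP GG).
by exists [::].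
Qed.

(** A spanning tree [S] inside [T] exhausts [T]: an edge [e] of [T] outside [S]
    would close up, together with a simple walk in [S] between its ends, to a
    circuit of [T]. *)
Lemma maximal_tree_spanning T r : maximal_tree T -> spanning_tree src tgt T r.
Proof.
move=> [/connected_by_edge_connected Tc noC].
have [S ST SP] := exists_spanning_tree r Tc.
suff -> : T = S by [].
apply/seteqP; split=> // e Te; apply: contrapT => nSe; apply: noC.
pose T' := [set f | T f /\ f <> e].
have [p wp pe] : exists2 p, walk T' (tgt e) p & walk_end (tgt e) p = src e.
  apply: edge_connected_walk => P Pst; apply: SP.1 => f Sf.
  by apply: Pst; split; [exact: ST | move=> fe; apply: nSe; rewrite -fe].
have [p' wp' [p'e up']] := simple_walk wp.
exists (src e), ((e, tgt e) :: p'); split=> //=.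
- by split=> //; [rewrite (edge_endP GG) | apply: walk_sub wp' => f []].
- by rewrite -pe -p'e.
- rewrite (simple_walk_edges wp' up') andbT.
  elim: p' (tgt e) wp' {p'e up'} => //= -[f v] p' IHp u [[_ fe] _ /IHp].
  by rewrite inE negb_or => ->; rewrite andbT; apply/eqP => ef; apply: fe.
Qed.

End Circuits.

(** * Generators and homomorphisms of the fundamental group *)

Section FundamentalGroupTheory.
Variables (Gamma : graph) (GG : graph_of_groups Gamma) (T : set (edge Gamma)).
Local Notation src e := (edge_end GG e true).
Local Notation tgt e := (edge_end GG e false).
Local Notation pi1 := (pi1 GG T).
Local Notation iota := (@vertex_map _ GG T _).
Local Notation phi e s := (edge_hom GG e s).

(** Putting [t_e = 1] on the tree gives all edges the same relation
    ([stable_relation]), so that tree edges need no separate treatment. *)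
Definition stable (e : edge Gamma) : pi1 :=
  if pselect (T e) is right eNT then generator _ (Gstable GG eNT) else 1.

Lemma stable_tree e : T e -> stable e = 1.
Proof. by rewrite /stable; case: pselect. Qed.

Lemma stable_relation e (h : edge_group GG e) :
  iota (phi e true h) * stable e = stable e * iota (phi e false h).
Proof.
rewrite /stable; case: pselect => eT.
  by rewrite mulg1 mul1g; apply/word_classP/cons_rel/pi1_tree.
have rel := cons_rel (pi1_stable (GG := GG) h eT).
apply: (mulgI (generator _ (Gstable GG eT))^-1); rewrite mulKg.
rewrite [_^-1]presented_invE [iota _ * _]presented_mulE [LHS]presented_mulE.
exact/word_classP.
Qed.

Lemma pi1_ind (P : pi1 -> Prop) :
  P 1 -> (forall v (g : vertex_group GG v), P (iota g)) -> (forall e, P (stable e)) ->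
  (forall a b, P a -> P b -> P (a * b)) -> (forall a, P a -> P a^-1) ->
  forall a, P a.
Proof.
move=> P1 Pv Pe PM PV; apply: presented_ind => // -[v g|e eNT]; first exact: Pv.
have := Pe e; rewrite /stable; case: pselect => // eNT'.
by rewrite (Prop_irrelevance eNT' eNT).
Qed.

(** The images [rho] of the vertex groups and [lam] of the stable letters need
    not satisfy [lam e = 1] on the tree.  Writing [lam] on the tree as the
    coboundary of [q] and conjugating the vertex group at [v] by [q v] makes
    these relations true. *)
Lemma pi1_hom (r : vertex Gamma) (L : groupType)
    (rho : forall v, {multiplicative vertex_group GG v -> L})
    (lam : edge Gamma -> L) :
  spanning_tree (edge_end GG ^~ true) (edge_end GG ^~ false) T r ->
  (forall e (h : edge_group GG e),
     rho _ (phi e true h) * lam e = lam e * rho _ (phi e false h)) ->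
  exists (f : {multiplicative pi1 -> L}) (q : vertex Gamma -> L),
  [/\ q r = 1, forall v (g : vertex_group GG v), f (iota g) = q v * rho v g * (q v)^-1
    & forall e, f (stable e) = q (src e) * lam e * (q (tgt e))^-1].
Proof.
move=> [_ /(_ L lam 1)[q qr qT]] rhoE.
pose f0 (x : pi1_gen GG T) := match x with
  | Gvertex v g => q v * rho v g * (q v)^-1
  | Gstable e _ => q (src e) * lam e * (q (tgt e))^-1
  end.
have [|f fE] := @presented_hom _ (@pi1_rel _ GG T) L f0.
  move=> _ _ [v g h|e h Te|e h eNT]; rewrite /= /eval_letter /= !mulg1.
  - by rewrite gmulfM !mulgA mulgVK.
  - by rewrite -(qT e Te) invgM !mulgA -(mulgA _ (lam e)) -rhoE !mulgA mulgK.
  - by rewrite !invgM invgK !mulgA !mulgVK -(mulgA _ _ (lam e)) rhoE !mulgA mulgVK.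
exists f, q; split=> // [v g|e]; first exact: fE.
rewrite /stable; case: pselect => eT; last exact: fE.
by rewrite hom1 qT // mulgV.
Qed.

End FundamentalGroupTheory.

(** * Coset representatives *)

Section Cosets.
Variables (A K : groupType) (theta : {multiplicative A -> K}).

(** All cosets are left cosets of [theta A] in [K].  The representative
    [coset_rep k] depends only on the coset of [k] because [xchoose] depends only
    on the extent of the predicate. *)
Definition in_coset (k : K) : pred K := fun j => `[< exists a, k = j * theta a >].

Fact in_coset_ex k : exists j, in_coset k j.
Proof. by exists k; apply/asboolP; exists 1; rewrite hom1 mulg1. Qed.

Definition coset_rep k := xchoose (in_coset_ex k).

Lemma coset_repM k a : coset_rep (k * theta a) = coset_rep k.
Proof.
apply: eq_xchoose => j; apply: asbool_equiv_eq; split=> -[b e].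
  by exists (b * a^-1); rewrite gmulfM homV mulgA -e mulgK.
by exists (b * a); rewrite gmulfM mulgA -e.
Qed.

(** The second clause normalises the transport of a representative to [1], also
    when [theta] is not injective. *)
Lemma transport_ex k :
  exists a, k = coset_rep k * theta a /\ (coset_rep k = k -> a = 1).
Proof.
have [kr|kr] := eqVneq (coset_rep k) k.
  by exists 1; rewrite hom1 mulg1.
have /asboolP[a e] := xchooseP (in_coset_ex k).
by exists a; split=> // kr'; rewrite kr' eqxx in kr.
Qed.

Definition transport k : A := sval (cid (transport_ex k)).

Lemma transportE k : coset_rep k * theta (transport k) = k.
Proof. by rewrite /transport; case: cid => a []. Qed.

Lemma coset_repK k : coset_rep (coset_rep k) = coset_rep k.
Proof. by rewrite -[in RHS](transportE k) coset_repM. Qed.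

Definition cosets := {k : K | coset_rep k == k}.

Definition to_coset k : cosets := exist _ (coset_rep k) (introT eqP (coset_repK k)).

Lemma to_cosetM k a : to_coset (k * theta a) = to_coset k.
Proof. by apply: val_inj; apply: coset_repM. Qed.

Lemma to_cosetK (x : cosets) : to_coset (sval x) = x.
Proof. by apply: val_inj; apply/eqP/(valP x). Qed.

(** For an injective [theta] the group [A] acts freely on [K], so the transport
    is unique and therefore equivariant. *)
Lemma transportM k a : injective theta -> transport (k * theta a) = transport k * a.
Proof.
move=> theta_inj; apply: theta_inj; apply: (mulgI (coset_rep k)).
by rewrite gmulfM mulgA transportE -(coset_repM k a) transportE.
Qed.

Lemma transport_rep (x : cosets) : transport (sval x) = 1.
Proof. by rewrite /transport; case: cid => a [_ /=]; apply; apply/eqP/(valP x). Qed.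

End Cosets.

(** * Vertex groups embed in the fundamental group *)

Section SymmetricGroup.
Variable M : Type.

(** The group of permutations of [M], each given with its inverse.  Products are
    in diagrammatic order: [a * b] is [a] followed by [b], so that groups act on
    [M] from the right. *)
Definition sym := {p : (M -> M) * (M -> M) | cancel p.1 p.2 /\ cancel p.2 p.1}.

HB.instance Definition _ := gen_eqMixin sym.
HB.instance Definition _ := gen_choiceMixin sym.

Definition sym_fun (a : sym) : M -> M := (sval a).1.

Lemma sym_ext (a b : sym) : sym_fun a =1 sym_fun b -> a = b.
Proof.
case: a b => [[f f'] [/= fK f'K]] [[g g'] [/= gK g'K]]; rewrite /sym_fun /= => fg.
apply: eq_exist; congr pair; apply/funext => x; first exact: fg.
by rewrite -{1}(g'K x) -fg fK.
Qed.

Fact sym_one_subproof : cancel (@id M) id /\ cancel (@id M) id.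
Proof. by []. Qed.
Definition sym_one : sym := exist _ (id, id) sym_one_subproof.

Definition sym_inv (a : sym) : sym :=
  exist _ ((sval a).2, (sval a).1) (conj (svalP a).2 (svalP a).1).

Definition sym_mul (a b : sym) : sym :=
  exist _ ((sval b).1 \o (sval a).1, (sval a).2 \o (sval b).2)
    (conj (can_comp (svalP b).1 (svalP a).1) (can_comp (svalP a).2 (svalP b).2)).

Fact sym_mulA : associative sym_mul.
Proof. by move=> a b c; apply: sym_ext. Qed.
Fact sym_mul1 : left_id sym_one sym_mul.
Proof. by move=> a; apply: sym_ext. Qed.
Fact sym_1mul : right_id sym_one sym_mul.
Proof. by move=> a; apply: sym_ext. Qed.
Fact sym_mulV : left_inverse sym_one sym_inv sym_mul.
Proof. by move=> a; apply: sym_ext; apply: (svalP a).2. Qed.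
Fact sym_Vmul : right_inverse sym_one sym_inv sym_mul.
Proof. by move=> a; apply: sym_ext; apply: (svalP a).1. Qed.

HB.instance Definition _ := isGroup.Build sym
  sym_mulA sym_mul1 sym_1mul sym_mulV sym_Vmul.

Lemma symP (f : M -> M) : bijective f -> exists a : sym, sym_fun a = f.
Proof. by case=> g fK gK; exists (exist _ (f, g) (conj fK gK)). Qed.

Lemma free_action (A : groupType) (f : A * M -> M) : bijective f ->
  exists rho : {multiplicative A -> sym},
    forall a x m, sym_fun (rho a) (f (x, m)) = f (x * a, m).
Proof.
case=> g fK gK; pose tr a m := f ((g m).1 * a, (g m).2).
have trK a : cancel (tr a) (tr a^-1).
  by move=> m; rewrite /tr fK mulgK -surjective_pairing gK.
have trVK a : cancel (tr a^-1) (tr a) by rewrite -{2}(invgK a).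
pose rho a : sym := exist _ (tr a, tr a^-1) (conj (trK a) (trVK a)).
have rhoM : {morph rho : a b / a * b}.
  by move=> a b; apply: sym_ext => m; rewrite /sym_fun /= /tr fK mulgA.
by exists (bundle_hom rhoM) => a x m; rewrite /sym_fun /= /tr fK.
Qed.

End SymmetricGroup.

Lemma injective_card_le (A B : Type) (f : A -> B) : injective f ->
  ([set: A] #<= [set: B])%card.
Proof.
move=> f_inj; have f_inj' : {in [set: A] &, injective f} by move=> x y _ _ /f_inj.
by rewrite -(card_le_eql (inj_card_eq f_inj')); apply: subset_card_le.
Qed.

Lemma bijection_of_injections (A B : Type) (f : A -> B) (g : B -> A) :
  injective f -> injective g -> exists h : A -> B, bijective h.
Proof.
move=> /injective_card_le fle /injective_card_le gle.
have /card_bijP[h h_bij] := Cantor_Bernstein fle gle.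
exists (fun x => val (h (exist _ x (mem_setT x)))).
apply: (bij_comp (f := val)).
  by exists (fun x => exist _ x (mem_setT x)) => x; first exact: val_inj.
apply: (bij_comp h_bij).
by exists val => x; last exact: val_inj.
Qed.

(** Prepending an entry embeds [Y * seq U] into [seq U]; an embedding in the
    other direction is clear, and the theorem of Cantor and Bernstein applies. *)
Lemma seq_absorbs (Y U : Type) (y0 : Y) (i : Y -> U) : injective i ->
  exists f : Y * seq U -> seq U, bijective f.
Proof.
move=> i_inj.
apply: (bijection_of_injections (f := fun p => i p.1 :: p.2) (g := pair y0)).
  by move=> [y m] [y' m'] /= [/i_inj -> ->].
by move=> m m' [].
Qed.

Section Absorption.
Variables (U : Type) (A H : groupType) (phi : {multiplicative H -> A}).
Variable (i : A -> U).
Hypotheses (phi_inj : injective phi) (i_inj : injective i).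

(** When [A] acts on [A * seq U] by translation, a subgroup [H] acts freely with
    orbit set [(A / H) * seq U], which is in bijection with [seq U].  The number
    of orbits is thus the same for every [H], and any two such actions of [H] are
    isomorphic. *)
Lemma free_orbits (rho : {multiplicative A -> sym (seq U)})
    (f : A * seq U -> seq U) : bijective f ->
  (forall a x m, sym_fun (rho a) (f (x, m)) = f (x * a, m)) ->
  exists2 b : H * seq U -> seq U, bijective b &
    forall h x m, sym_fun (rho (phi h)) (b (x, m)) = b (x * h, m).
Proof.
move=> [f' fK f'K] rhoE.
have [|g [g' gK g'K]] := @seq_absorbs (cosets phi) U (to_coset phi 1) (i \o val).
  by move=> x y /i_inj /val_inj.
exists (fun p => let rm := g' p.2 in f (sval rm.1 * phi p.1, rm.2)); last first.
  by move=> h x m; rewrite /= rhoE gmulfM mulgA.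
exists (fun m => let am := f' m in
  (transport phi am.1, g (to_coset phi am.1, am.2))) => [[x m]|m] /=.
  rewrite fK /= transportM // transport_rep // mul1g to_cosetM to_cosetK.
  by rewrite -surjective_pairing g'K.
by rewrite gK /= transportE -surjective_pairing f'K.
Qed.

End Absorption.

Section VertexGroupsEmbed.
Variables (Gamma : graph) (GG : graph_of_groups Gamma) (T : set (edge Gamma)).

(** All vertex groups act freely on [seq U], where [U] is their disjoint union.
    By [free_orbits] the two actions of an edge group on that set are isomorphic,
    so they are conjugate under some permutation [lam e].  This makes [seq U] a
    representation of the fundamental group that is faithful on vertex groups. *)
Lemma vertex_map_inj v : maximal_tree T -> injective (@vertex_map _ GG T v).
Proof.
move=> Tmax; pose U := {v & vertex_group GG v}.
pose i v (g : vertex_group GG v) : U := existT _ v g.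
have i_inj w : injective (i w).
  by move=> g h; exact: (@existT_inj2 {classic vertex Gamma}).
have f w : {f : vertex_group GG w * seq U -> seq U | bijective f}.
  by apply: cid; apply: seq_absorbs (i_inj w); exact: 1.
have rho w : {rho : {multiplicative vertex_group GG w -> sym (seq U)} |
    forall a x m, sym_fun (rho a) (sval (f w) (x, m)) = sval (f w) (x * a, m)}.
  by apply: cid; apply: free_action (svalP (f w)).
have /(_ _ _)/cid2 b e s := free_orbits (@edge_hom_inj _ GG e s) (@i_inj _)
  (svalP (f _)) (svalP (rho (edge_end GG e s))).
have /choice[lam lamP] : forall e, exists a, forall h m,
    sym_fun a (s2val (b e true) (h, m)) = s2val (b e false) (h, m).
  move=> e; have [b' bK b'K] := s2valP (b e true).
  have [|a aE] := @symP _ (s2val (b e false) \o b').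
    by apply: bij_comp (s2valP (b e false)) _; exists (s2val (b e true)).
  by exists a => h m; rewrite aE /= bK.
have [e h|F [q [_ FE _]]] := pi1_hom (rho := fun w => sval (rho w)) (lam := lam)
    (maximal_tree_spanning GG v Tmax).
  apply: sym_ext => m; have [b' _ b'K] := s2valP (b e true).
  rewrite -(b'K m); case: (b' m) => x {}m.
  rewrite /sym_fun /= -!/(sym_fun _) (s2valP' (b e true)) !lamP.
  by rewrite (s2valP' (b e false)).
move=> g g' /(congr1 F); rewrite !FE => /mulIg/mulgI /(congr1 (@sym_fun _)).
move=> /(congr1 (@^~ (sval (f v) (1, [::])))); rewrite !(svalP (rho v)) !mul1g.
by move=> /(bij_inj (svalP (f v)))[].
Qed.

End VertexGroupsEmbed.

(** * Wreath products *)

Section WreathProduct.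
Variables (P K : groupType).

(** The unrestricted wreath product, for the right regular action of [K]: a pair
    [(f, k)] stands for [f] followed by [k].  A homomorphism [g |-> (c _ g, s g)]
    into it is a homomorphism [s] together with a cocycle, that is,
    [c k (g * h) = c k g * c (k * s g) h]. *)
Definition wreath : Type := ((K -> P) * K)%type.

HB.instance Definition _ := gen_eqMixin wreath.
HB.instance Definition _ := gen_choiceMixin wreath.

Definition wreath_one : wreath := (fun=> 1, 1).
Definition wreath_inv (a : wreath) : wreath :=
  (fun k => (a.1 (k * a.2^-1))^-1, a.2^-1).
Definition wreath_mul (a b : wreath) : wreath :=
  (fun k => a.1 k * b.1 (k * a.2), a.2 * b.2).

Fact wreath_mulA : associative wreath_mul.
Proof.
move=> a b c; rewrite /wreath_mul /= mulgA; congr pair.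
by apply/funext => k; rewrite !mulgA.
Qed.
Fact wreath_mul1 : left_id wreath_one wreath_mul.
Proof.
move=> [f k]; rewrite /wreath_mul /= mul1g; congr pair.
by apply/funext => j; rewrite mul1g mulg1.
Qed.
Fact wreath_1mul : right_id wreath_one wreath_mul.
Proof.
move=> [f k]; rewrite /wreath_mul /= mulg1; congr pair.
by apply/funext => j; rewrite mulg1.
Qed.
Fact wreath_mulV : left_inverse wreath_one wreath_inv wreath_mul.
Proof.
move=> [f k]; rewrite /wreath_mul /= mulVg; congr pair.
by apply/funext => j; rewrite mulVg.
Qed.
Fact wreath_Vmul : right_inverse wreath_one wreath_inv wreath_mul.
Proof.
move=> [f k]; rewrite /wreath_mul /= mulgV; congr pair.
by apply/funext => j; rewrite mulgK mulgV.
Qed.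

HB.instance Definition _ := isGroup.Build wreath
  wreath_mulA wreath_mul1 wreath_1mul wreath_mulV wreath_Vmul.

Lemma wreath_mulE (a b : wreath) k : (a * b).1 k = a.1 k * b.1 (k * a.2).
Proof. by []. Qed.

Lemma wreath_invE (a : wreath) k : (a^-1).1 k = (a.1 (k * a.2^-1))^-1.
Proof. by []. Qed.

End WreathProduct.

(** * The covering graph and the splitting of the kernel *)

Section Kurosh.
Variables (Gamma : graph) (GG : graph_of_groups Gamma) (T : set (edge Gamma)).
Variables (K : groupType) (sigma : {multiplicative pi1 GG T -> K}).
Variable (v0 : vertex Gamma).
Local Notation src e := (edge_end GG e true).
Local Notation tgt e := (edge_end GG e false).
Local Notation pi1 := (pi1 GG T).
Local Notation iota := (@vertex_map _ GG T _).
Local Notation phi e s := (edge_hom GG e s).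
Local Notation stable e := (stable GG T e).

Definition vsigma v : {multiplicative vertex_group GG v -> K} :=
  sigma \o @vertex_map _ GG T v.
Definition esigma e : {multiplicative edge_group GG e -> K} :=
  vsigma (src e) \o phi e true.
Definition tsigma e : K := sigma (stable e).

Hypotheses (tree_T : spanning_tree (edge_end GG ^~ true) (edge_end GG ^~ false) T v0)
  (sigma_onto : range sigma = [set: K])
  (esigma_inj : forall e, injective (esigma e)).

Lemma vsigmaE v g : vsigma v g = sigma (iota g).
Proof. by []. Qed.

Lemma sigma_relation e h :
  vsigma (src e) (phi e true h) * tsigma e =
  tsigma e * vsigma (tgt e) (phi e false h).
Proof. by rewrite !vsigmaE -!gmulfM stable_relation. Qed.

Lemma tsigma_tree e : T e -> tsigma e = 1.
Proof. by move=> Te; rewrite /tsigma stable_tree // hom1. Qed.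

(** The covering of [Gamma] on which [pi1] acts through [K]: [vertex_over v k]
    and [edge_over e k] are the cells over [v] and [e] through the point [k]. *)
Definition cover_vertex := {v : vertex Gamma & cosets (vsigma v)}.
Definition cover_edge := {e : edge Gamma & cosets (esigma e)}.

Definition vertex_over v k : cover_vertex := existT _ v (to_coset (vsigma v) k).
Definition edge_over e k : cover_edge := existT _ e (to_coset (esigma e) k).
Definition base (x : cover_vertex) : K := sval (tagged x).
Definition edge_base (f : cover_edge) : K := sval (tagged f).
Definition cover_src f := vertex_over (src (tag f)) (edge_base f).
Definition cover_tgt f := vertex_over (tgt (tag f)) (edge_base f * tsigma (tag f)).

Lemma vertex_overM v k g : vertex_over v (k * vsigma v g) = vertex_over v k.
Proof. by rewrite /vertex_over to_cosetM. Qed.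

Lemma vertex_over_base x : vertex_over (tag x) (base x) = x.
Proof. by case: x => v x; rewrite /vertex_over /= to_cosetK. Qed.

Lemma edge_over_base f : edge_over (tag f) (edge_base f) = f.
Proof. by case: f => e x; rewrite /edge_over /= to_cosetK. Qed.

Lemma edge_base_srcE e k :
  edge_base (edge_over e k) *
    vsigma (src e) (phi e true (transport (esigma e) k)) = k.
Proof. exact: (transportE (esigma e)). Qed.

Lemma edge_base_tgtE e k : edge_base (edge_over e k) * tsigma e *
    vsigma (tgt e) (phi e false (transport (esigma e) k)) = k * tsigma e.
Proof. by rewrite -mulgA -sigma_relation mulgA edge_base_srcE. Qed.

Lemma cover_src_over e k : cover_src (edge_over e k) = vertex_over (src e) k.
Proof. by rewrite -[in RHS](edge_base_srcE e k) vertex_overM. Qed.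

Lemma cover_tgt_over e k :
  cover_tgt (edge_over e k) = vertex_over (tgt e) (k * tsigma e).
Proof. by rewrite -[in RHS](edge_base_tgtE e k) vertex_overM. Qed.

(** The set of all [g] such that [k] and [k * sigma g] always lie over the same
    component is a subgroup.  It contains the generators, by the edges of the
    covering graph, so it is everything, and [sigma] is onto. *)
Lemma cover_connected : edge_connected cover_src cover_tgt setT.
Proof.
move=> P Pst.
have Pe e k : P (vertex_over (src e) k) <-> P (vertex_over (tgt e) (k * tsigma e)).
  by rewrite -cover_src_over -cover_tgt_over; apply: Pst.
have Pv v w k : P (vertex_over v k) -> P (vertex_over w k).
  apply: (tree_T.1 (fun v => P (vertex_over v k))) => e Te.
  by rewrite (Pe e k) tsigma_tree // mulg1.
have Pg g : forall v k, P (vertex_over v k) <-> P (vertex_over v (k * sigma g)).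
  elim/pi1_ind: g => [v k|w g v k|e v k|a b IHa IHb v k|a IHa v k].
  - by rewrite hom1 mulg1.
  - have -> : sigma (iota g) = vsigma w g by [].
    by split=> /(Pv _ w) Pw; apply: (Pv w); rewrite vertex_overM in Pw *.
  - by split=> Pvk; [apply: (Pv (tgt e)); apply/(Pe e); apply: Pv Pvk
                    |apply: (Pv (src e)); apply/(Pe e); apply: Pv Pvk].
  - by rewrite gmulfM mulgA -IHb -IHa.
  - by rewrite homV (IHa v (k * _)) mulgVK.
have P1 x : P x <-> P (vertex_over v0 1).
  rewrite -(vertex_over_base x); have [g _ sg] : range sigma (base x).
    by rewrite sigma_onto.
  rewrite -sg -(mul1g (sigma g)) -(Pg g); split; exact: Pv.
by move=> x y /P1 ?; apply/P1.
Qed.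

Variables (S : set cover_edge) (root : cover_vertex).
Hypothesis tree_S : spanning_tree cover_src cover_tgt S root.

Local Notation Omega v :=
  (intersection (kernel sigma) (vertex_subgroup GG T v)).

Definition factor (i : option cover_vertex) : groupType :=
  if i is Some x then subgroup (Omega (tag x)) else free_group {f | ~ S f}.

Local Notation P := (free_product factor).

(** Extending the embedding of a factor by [1] to all of [pi1] avoids carrying
    membership proofs in the formulas for cocycles. *)
Definition vertex_elt (x : cover_vertex) (z : pi1) : P :=
  oapp (@factor_map _ factor (Some x)) 1 (insub z : option (subgroup (Omega (tag x)))).

(** The edges of the spanning tree are collapsed. *)
Definition edge_elt (f : cover_edge) : P :=
  if pselect (S f) is right nS
  then @factor_map _ factor None (generator _ (exist (fun f => ~ S f) f nS)) else 1.

Lemma vertex_eltE x (z : subgroup (Omega (tag x))) :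
  vertex_elt x (val z) = @factor_map _ factor (Some x) z.
Proof. by rewrite /vertex_elt valK. Qed.

Lemma vertex_eltM x : {in Omega (tag x) &, {morph vertex_elt x : z w / z * w}}.
Proof.
move=> z w zO wO; rewrite -[z]/(val (Sub z zO : subgroup (Omega (tag x)))).
rewrite -[w]/(val (Sub w wO : subgroup (Omega (tag x)))) -gmulfM.
by rewrite !vertex_eltE gmulfM.
Qed.

Lemma vertex_elt1 x : vertex_elt x 1 = 1.
Proof. by apply: (mulgI (vertex_elt x 1)); rewrite -vertex_eltM ?gpred1 // !mulg1. Qed.

Lemma edge_elt_tree f : S f -> edge_elt f = 1.
Proof. by rewrite /edge_elt; case: pselect. Qed.

Lemma factor_ind (Q : P -> Prop) :
  Q 1 -> (forall x z, z \in Omega (tag x) -> Q (vertex_elt x z)) ->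
  (forall f, Q (edge_elt f)) -> (forall a b, Q a -> Q b -> Q (a * b)) ->
  (forall a, Q a -> Q a^-1) -> forall a, Q a.
Proof.
move=> Q1 Qv Qe QM QV; apply: free_product_ind => // -[x|] z.
  by rewrite -vertex_eltE; apply/Qv/valP.
elim/presented_ind: z => [|[f nS]|a b Qa Qb|a Qa].
- by rewrite hom1.
- have := Qe f; rewrite /edge_elt; case: pselect => // nS'.
  by rewrite (Prop_irrelevance nS' nS).
- by rewrite gmulfM; apply: QM.
- by rewrite homV; apply: QV.
Qed.

(** The loop that goes from the representative of the coset of [k] to [k], then
    along [g], and back to the representative. *)
Definition local_loop v k g : pi1 :=
  iota (transport (vsigma v) k) * iota g *
  (iota (transport (vsigma v) (k * vsigma v g)))^-1.

Arguments local_loop : clear implicits.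

Lemma sigma_transport v k :
  sigma (iota (transport (vsigma v) k)) = (base (vertex_over v k))^-1 * k.
Proof.
by apply: (mulgI (base (vertex_over v k))); rewrite mulVKg; apply: transportE.
Qed.

Lemma local_loop_Omega v k g : local_loop v k g \in Omega v.
Proof.
apply/andP; split; last by rewrite !(gpredM, gpredVr) //; apply/asboolP; eexists.
rewrite inE !gmulfM homV !sigma_transport vertex_overM -vsigmaE.
by rewrite !invgM invgK !mulgA !mulgK mulVg.
Qed.

Definition vertex_cocycle v k g : P := vertex_elt (vertex_over v k) (local_loop v k g).

Arguments vertex_cocycle : clear implicits.

Lemma vertex_cocycleM v k g h :
  vertex_cocycle v k (g * h) =
  vertex_cocycle v k g * vertex_cocycle v (k * vsigma v g) h.
Proof.
rewrite /vertex_cocycle vertex_overM -vertex_eltM ?local_loop_Omega //.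
by rewrite /local_loop !gmulfM !mulgA mulgVK.
Qed.

Lemma vertex_cocycle1 v k : vertex_cocycle v k 1 = 1.
Proof. by rewrite /vertex_cocycle /local_loop !hom1 !mulg1 mulgV vertex_elt1. Qed.

(** The edge through [k] is slid by an element of the edge group to the edge
    through the chosen representative, to which [edge_elt] is attached. *)
Definition edge_cocycle e k : P :=
  vertex_cocycle (src e) k (phi e true (transport (esigma e) k)^-1) *
  edge_elt (edge_over e k) *
  vertex_cocycle (tgt e) (edge_base (edge_over e k) * tsigma e)
    (phi e false (transport (esigma e) k)).

Lemma edge_cocycle_base f :
  edge_cocycle (tag f) (edge_base f) = edge_elt f.
Proof.
rewrite /edge_cocycle transport_rep invg1 !hom1 !vertex_cocycle1 mulg1 mul1g.
by rewrite edge_over_base.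
Qed.

(** Multiplying [k] by the image of [h] multiplies its transport by [h], by
    injectivity of [esigma]; the extra factors at the two ends are the two
    images of [h]. *)
Lemma edge_cocycleM e k h :
  vertex_cocycle (src e) k (phi e true h) *
    edge_cocycle e (k * vsigma (src e) (phi e true h)) =
  edge_cocycle e k * vertex_cocycle (tgt e) (k * tsigma e) (phi e false h).
Proof.
have oE : edge_over e (k * vsigma (src e) (phi e true h)) = edge_over e k.
  by rewrite /edge_over (to_cosetM (esigma e) k h).
have tE : transport (esigma e) (k * vsigma (src e) (phi e true h)) =
    transport (esigma e) k * h by apply: (transportM k h).
rewrite /edge_cocycle oE tE !mulgA -vertex_cocycleM -!gmulfM invgM mulVKg.
by rewrite gmulfM vertex_cocycleM edge_base_tgtE !mulgA.
Qed.

Definition vertex_lift v (g : vertex_group GG v) : wreath P K :=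
  (vertex_cocycle v ^~ g, vsigma v g).

Fact vertex_liftM v : {morph @vertex_lift v : g h / g * h}.
Proof.
move=> g h; rewrite /vertex_lift gmulfM; congr pair; apply/funext => k.
exact: vertex_cocycleM.
Qed.

Definition edge_lift e : wreath P K := (edge_cocycle e, tsigma e).

(** The pairs (cocycle, [sigma]) satisfy the edge relations, hence [pi1_hom] maps
    [pi1] to the wreath product.  The gauge [q] provided by [pi1_hom] projects to
    [1] in [K], since all tree edges do; so the homomorphism still lies over
    [sigma], and only the cocycle is changed, by the coboundary of [a]. *)
Lemma lift_exists : exists (rho : {multiplicative pi1 -> wreath P K})
    (a : vertex Gamma -> K -> P),
  [/\ forall g, (rho g).2 = sigma g,
      forall v k g, (rho (iota g)).1 k =
        a v k * vertex_cocycle v k g * (a v (k * vsigma v g))^-1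
    & forall e k, (rho (stable e)).1 k =
        a (src e) k * edge_cocycle e k * (a (tgt e) (k * tsigma e))^-1].
Proof.
have [e h|rho [q [q0 rhov rhoe]]] := pi1_hom
    (rho := fun v => bundle_hom (@vertex_liftM v)) (lam := edge_lift) tree_T.
  by congr pair; [apply/funext => k; exact: edge_cocycleM | exact: sigma_relation].
have q2 v : (q v).2 = 1.
  apply: (tree_T.1 (fun v => (q v).2 = 1) _ v0); last by rewrite q0.
  move=> e Te; have := congr1 snd (rhoe e).
  rewrite stable_tree // hom1 => /=; rewrite tsigma_tree // mulg1 => /esym qe.
  by rewrite (divg1_eq qe).
exists rho, (fun v => (q v).1); split=> [g|v k g|e k].
- elim/pi1_ind: g => [|v g|e|a b IHa IHb|a IHa].
  + by rewrite !hom1.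
  + by rewrite rhov /= q2 mul1g invg1 mulg1.
  + by rewrite rhoe /= !q2 mul1g invg1 mulg1.
  + by rewrite !gmulfM -IHa -IHb.
  + by rewrite !homV -IHa.
- by rewrite rhov /= !q2 mulg1 !mul1g invg1 mulg1.
- by rewrite rhoe /= !q2 mulg1 !mul1g invg1 mulg1.
Qed.

(** The element of [pi1] that leads from the representative at the source of [f]
    across [f] to the representative at its target. *)
Definition edge_label f : pi1 :=
  iota (transport (vsigma (src (tag f))) (edge_base f)) * stable (tag f) *
  (iota (transport (vsigma (tgt (tag f))) (edge_base f * tsigma (tag f))))^-1.

Lemma sigma_edge_label f :
  sigma (edge_label f) = (base (cover_src f))^-1 * base (cover_tgt f).
Proof.
by rewrite !gmulfM homV !sigma_transport -/(tsigma _) !invgM invgK !mulgA !mulgK.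
Qed.

(** The elements read along the paths of [S] from [root], preceded by an element
    over the representative at [root]. *)
Lemma tree_paths_exist : exists2 q : cover_vertex -> pi1,
  forall x, sigma (q x) = base x &
  forall f, S f -> q (cover_src f) * edge_label f = q (cover_tgt f).
Proof.
have [g0 _ sg0] : range sigma (base root) by rewrite sigma_onto.
have [q qroot qS] := tree_S.2 pi1 edge_label g0; exists q => // x.
apply: (tree_S.1 (fun x => sigma (q x) = base x) _ root); last by rewrite qroot.
move=> f /qS <-; rewrite gmulfM sigma_edge_label mulgA; split=> [->|].
  by rewrite mulgV mul1g.
by rewrite -{2}(mul1g (base (cover_tgt f))) => /mulIg /divg1_eq.
Qed.

Section KernelIsFreeProduct.
Variables (rho : {multiplicative pi1 -> wreath P K}) (a : vertex Gamma -> K -> P).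
Variable q : cover_vertex -> pi1.
Hypotheses (rho2 : forall g, (rho g).2 = sigma g)
  (rho_vertex : forall v k g, (rho (iota g)).1 k =
     a v k * vertex_cocycle v k g * (a v (k * vsigma v g))^-1)
  (rho_edge : forall e k, (rho (stable e)).1 k =
     a (src e) k * edge_cocycle e k * (a (tgt e) (k * tsigma e))^-1)
  (sigma_q : forall x, sigma (q x) = base x)
  (q_tree : forall f, S f -> q (cover_src f) * edge_label f = q (cover_tgt f)).

Local Notation cocycle k g := ((rho g).1 k).

Lemma cocycleM k g h : cocycle k (g * h) = cocycle k g * cocycle (k * sigma g) h.
Proof. by rewrite gmulfM wreath_mulE rho2. Qed.

Lemma cocycle1 k : cocycle k 1 = 1.
Proof. by rewrite hom1. Qed.

Lemma cocycleV k g : cocycle k g^-1 = (cocycle (k * sigma g^-1) g)^-1.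
Proof. by rewrite (homV rho) wreath_invE rho2 homV. Qed.

(** The path of the spanning tree to [vertex_over v k], continued to the point
    [k].  It is locked because it is itself a product, which associativity would
    otherwise take apart. *)
Definition tpath v k : pi1 :=
  locked (q (vertex_over v k) * iota (transport (vsigma v) k)).
Arguments tpath : clear implicits.

Lemma tpathE v k : tpath v k = q (vertex_over v k) * iota (transport (vsigma v) k).
Proof. by rewrite /tpath -lock. Qed.

Lemma sigma_tpath v k : sigma (tpath v k) = k.
Proof. by rewrite tpathE gmulfM sigma_q sigma_transport mulVKg. Qed.

Lemma tpath_vertex v k g : q (vertex_over v k) * local_loop v k g =
  tpath v k * iota g * (tpath v (k * vsigma v g))^-1 * q (vertex_over v k).
Proof. by rewrite !tpathE vertex_overM invgM !mulgA mulgVK. Qed.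

Lemma tpath_edge f : q (cover_src f) * edge_label f * (q (cover_tgt f))^-1 =
  tpath (src (tag f)) (edge_base f) * stable (tag f) *
  (tpath (tgt (tag f)) (edge_base f * tsigma (tag f)))^-1.
Proof. by rewrite !tpathE invgM !mulgA. Qed.

(** A vertex factor is conjugated by the path to its vertex; a free generator is
    sent to the loop that follows the tree to the edge, crosses it, and returns
    along the tree. *)
Definition factor_lift i : factor i -> pi1 :=
  match i with
  | Some x => fun z => q x * val z * (q x)^-1
  | None => sval (cid (@free_group_hom {f | ~ S f} pi1 (fun f =>
      q (cover_src (sval f)) * edge_label (sval f) * (q (cover_tgt (sval f)))^-1)))
  end.

Fact factor_liftM i : {morph @factor_lift i : y z / y * z}.
Proof.
case: i => [x|] y z; last exact: gmulfM.
have vM := valM (y : subgroup (Omega (tag x))) z.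
by rewrite /= [X in _ * X * _]vM !mulgA mulgVK.
Qed.

Lemma realization_exists : exists beta : {multiplicative P -> pi1},
  (forall x z, z \in Omega (tag x) -> beta (vertex_elt x z) = q x * z * (q x)^-1) /\
  (forall f, beta (edge_elt f) = q (cover_src f) * edge_label f * (q (cover_tgt f))^-1).
Proof.
have [beta betaE] := free_product_hom (fun i => bundle_hom (@factor_liftM i)).
exists beta; split=> [x z zO|f].
  rewrite -[z]/(val (Sub z zO : subgroup (Omega (tag x)))) vertex_eltE.
  exact: betaE.
rewrite /edge_elt; case: pselect => [Sf|nS]; first by rewrite hom1 q_tree // mulgV.
by rewrite betaE /=; case: cid => h /= ->.
Qed.

Variable beta : {multiplicative P -> pi1}.
Hypotheses (beta_vertex : forall x z, z \in Omega (tag x) ->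
    beta (vertex_elt x z) = q x * z * (q x)^-1)
  (beta_edge : forall f, beta (edge_elt f) =
    q (cover_src f) * edge_label f * (q (cover_tgt f))^-1).

Lemma sigma_realization p : sigma (beta p) = 1.
Proof.
elim/factor_ind: p => [|x z zO|f|p p' IHp IHp'|p IHp].
- by rewrite !hom1.
- have /andP[+ _] := zO; rewrite inE => /eqP sz.
  by rewrite beta_vertex // !gmulfM sz mulg1 homV mulgV.
- by rewrite beta_edge 2!gmulfM homV !sigma_q sigma_edge_label mulVKg mulgV.
- by rewrite !gmulfM IHp IHp' mulg1.
- by rewrite !homV IHp invg1.
Qed.

Lemma realization_vertex_cocycle v k g : beta (vertex_cocycle v k g) =
  tpath v k * iota g * (tpath v (k * vsigma v g))^-1.
Proof.
by rewrite beta_vertex ?local_loop_Omega // tpath_vertex mulgK.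
Qed.

Lemma realization_edge_cocycle e k : beta (edge_cocycle e k) =
  tpath (src e) k * stable e * (tpath (tgt e) (k * tsigma e))^-1.
Proof.
rewrite !gmulfM beta_edge tpath_edge !realization_vertex_cocycle edge_base_tgtE.
set s := transport _ _.
have -> : k * vsigma (src e) (phi e true s^-1) = edge_base (edge_over e k).
  by rewrite -[X in X * _](edge_base_srcE e k) !homV mulgK.
rewrite -[tag _]/e !mulgA !mulgVK homV (homV (@vertex_map _ _ _ _)).
rewrite -!mulgA; congr (_ * _); rewrite !mulgA; congr (_ * _).
by rewrite -mulgA -stable_relation mulKg.
Qed.

(** Both sides are cocycles, so it suffices to compare them on the generators.
    For the vertex groups and stable letters the comparison holds with the path
    [beta (a v k) * tpath v k] in place of [X k]; it does not depend on [v]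
    because it is constant along the edges of [T].  On the kernel of [sigma], at
    [k = 1], the right-hand side is conjugation by [X 1]. *)
Lemma realization_cocycle : exists2 X : K -> pi1, forall k, sigma (X k) = k &
  forall g k, beta (cocycle k g) = X k * g * (X (k * sigma g))^-1.
Proof.
have aE v k : beta (a v k) * tpath v k = beta (a v0 k) * tpath v0 k.
  pose R v := beta (a v k) * tpath v k = beta (a v0 k) * tpath v0 k.
  apply: (tree_T.1 R _ v0 v erefl) => e Te; rewrite /R.
  have := congr1 beta (rho_edge e k).
  rewrite 2!gmulfM homV realization_edge_cocycle stable_tree // cocycle1 hom1.
  rewrite tsigma_tree // !mulg1.
  by rewrite mulgA -(mulgA _ _ (beta (a (tgt e) k))^-1) -invgM => /esym /divg1_eq ->.
have [X XE] : exists X, forall k, X k = beta (a v0 k) * tpath v0 k.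
  by exists (fun k => beta (a v0 k) * tpath v0 k).
exists X => [k|g]; first by rewrite XE gmulfM sigma_realization mul1g sigma_tpath.
elim/pi1_ind: g => [k|v g k|e k|g h IHg IHh k|g IHg k].
- by rewrite cocycle1 !hom1 !mulg1 mulgV.
- rewrite rho_vertex 2!gmulfM homV realization_vertex_cocycle !XE -!(aE v) -vsigmaE.
  by rewrite invgM !mulgA.
- rewrite rho_edge 2!gmulfM homV realization_edge_cocycle !XE.
  rewrite -(aE (src e)) -(aE (tgt e)).
  by rewrite invgM !mulgA.
- by rewrite cocycleM !gmulfM IHg IHh !mulgA mulgVK.
- by rewrite cocycleV homV IHg homV mulgVK !invgM invgK mulgA.
Qed.

(** The discrepancy [D x] between the cocycle along the path to [x] and the gauge
    at [x] is constant along the edges of [S], on which both [edge_elt] and the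
    loop of the edge are trivial.  On each generator the composite is therefore
    conjugation by the same element [D root]. *)
Lemma cocycle_realization : exists d : P, forall p, cocycle 1 (beta p) = d * p * d^-1.
Proof.
have [D DE0] : exists D, forall x, D x = cocycle 1 (q x) * a (tag x) (base x).
  by exists (fun x => cocycle 1 (q x) * a (tag x) (base x)).
have cocycle_path v k : cocycle 1 (tpath v k) = D (vertex_over v k) * (a v k)^-1.
  rewrite tpathE cocycleM mul1g sigma_q rho_vertex /vertex_cocycle /local_loop.
  rewrite [iota (transport _ (base _))](_ : _ = 1); last first.
    by rewrite /base transport_rep hom1.
  by rewrite (transportE (vsigma v) k) mul1g mulgV vertex_elt1 mulg1 DE0 !mulgA.
have edgeE f : cocycle 1 (q (cover_src f) * edge_label f * (q (cover_tgt f))^-1) =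
    D (cover_src f) * edge_elt f * (D (cover_tgt f))^-1.
  rewrite tpath_edge 2!cocycleM cocycleV !mul1g gmulfM homV !sigma_tpath.
  rewrite -/(tsigma _) mulgV.
  rewrite rho_edge edge_cocycle_base !cocycle_path.
  by rewrite invgM invgK !mulgA !mulgVK.
have DE x : D x = D root.
  apply: (tree_S.1 (fun x => D x = D root) _ root x erefl) => f Sf.
  have := edgeE f; rewrite q_tree // mulgV cocycle1 edge_elt_tree // mulg1.
  by move=> /esym /divg1_eq ->.
exists (D root) => p; elim/factor_ind: p => [|x z zO|f|p p' IHp IHp'|p IHp].
- by rewrite hom1 cocycle1 mulg1 mulgV.
- have /andP[+ /asboolP[g zE]] := zO; rewrite inE -zE -vsigmaE => /eqP tg.
  rewrite beta_vertex -?zE ?cocycleM ?cocycleV; last by rewrite zE.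
  rewrite !gmulfM homV -!vsigmaE tg !mulg1 mul1g sigma_q mulgV rho_vertex tg mulg1.
  rewrite /vertex_cocycle /local_loop vertex_over_base tg mulg1.
  rewrite /base transport_rep hom1 mul1g invg1 mulg1 -(DE x) DE0 /base.
  by rewrite invgM !mulgA.
- by rewrite beta_edge edgeE !DE.
- by rewrite gmulfM cocycleM sigma_realization mulg1 IHp IHp' !mulgA mulgVK.
- by rewrite homV cocycleV homV sigma_realization invg1 mulg1 IHp !invgM invgK mulgA.
Qed.

End KernelIsFreeProduct.

Lemma kernel_free_product : isomorphic (subgroup (kernel sigma)) P.
Proof.
have [rho [a [rho2 rhov rhoe]]] := lift_exists.
have [q sq qS] := tree_paths_exist.
have [beta [bv be]] := realization_exists qS.
have [X sX betaE] := realization_cocycle rho2 rhov rhoe sq bv be.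
have [d dE] := cocycle_realization rho2 rhov rhoe sq qS bv be.
have ker (n : subgroup (kernel sigma)) : sigma (val n) = 1.
  by have := valP n; rewrite inE => /eqP.
pose alpha (n : subgroup (kernel sigma)) := (rho (val n)).1 1.
have alphaM : {morph alpha : m n / m * n}.
  by move=> m n; rewrite /alpha valM (cocycleM rho2) ker mulg1.
exists (bundle_hom alphaM); apply: inj_surj_bij => [m n /= /(congr1 beta)|p].
  by rewrite /alpha !betaE !ker => /mulIg /mulgI /val_inj.
have nP : beta (d^-1 * p * d) \in kernel sigma.
  by rewrite inE (sigma_realization sq bv be).
exists (Sub (beta (d^-1 * p * d)) nP); rewrite /= /alpha dE.
by rewrite !mulgA mulgV mul1g mulgK.
Qed.

End Kurosh.

Theorem proposition3p4 (Gamma : graph) (GG : graph_of_groups Gamma)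
    (T : set (edge Gamma)) (C : groupType -> Prop) (K : groupType)
    (sigma : {multiplicative pi1 GG T -> K}) :
  inhabited (vertex Gamma) ->
  connected Gamma ->
  maximal_tree T ->
  root_class C ->
  C K ->
  range sigma = [set: K] ->
  (forall (e : edge Gamma) (s : bool),
     {in edge_subgroup GG T e s &, injective sigma}) ->
  extension_class
    (P_class (fun v : vertex Gamma =>
       subgroup (intersection (kernel sigma) (vertex_subgroup GG T v))))
    C (pi1 GG T).
Proof.
move=> [v0] _ Tmax _ CK sigma_onto sigma_inj.
have tree_T := maximal_tree_spanning GG v0 Tmax.
have edge_inj e : injective (esigma sigma e).
  move=> h h' /sigma_inj hh'; apply: (edge_hom_inj (e := e) (s := true)).
  by apply: (vertex_map_inj Tmax); apply: hh'; apply/asboolP; eexists.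
have [S _ tree_S] := exists_spanning_tree (vertex_over sigma v0 1)
  (cover_connected tree_T sigma_onto).
exists (free_product (factor S)), K; split=> //.
  exists (option (cover_vertex sigma)), (factor S); split; last first.
    by exists idfun; exists idfun.
  move=> [x|]; [right; exists (tag x); exists idfun => // | left].
  by exists {f | ~ S f}, idfun; exists idfun.
exists (kernel_normal sigma); split; last exact: quotient_kernel.
exact (kernel_free_product tree_T sigma_onto edge_inj tree_S).
Qed.
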